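(* Let $X$ be a Banach space with separable dual $X^*$. Assume that for all $n\in\mathbb{N}$, $\ell_\infty^n$ is in the $n$-th asymptotic structure of $X$ up to a constant $D\ge1$ ($D$ independent of $n$). Then for each $\varepsilon>0$, $X$ contains $(D(1+\varepsilon),1+\varepsilon)$-good $\ell_\infty$-trees of arbitrary height. In particular, if $\ell_\infty^n$ is in the $n$-th asymptotic structure of $X$ for all $n\in\mathbb{N}$, then $X$ contains good $\ell_\infty$-trees of arbitrary height almost isometrically.
   Context: Asymptotic structure: $\mathrm{cof}(X)$ denotes the set of (closed) finite-codimensional subspaces of $X$, and $S_Z$ the unit sphere of $Z$. Sequences $(x_j)_{j=1}^n$, $(e_j)_{j=1}^n$ are $K$-equivalent if there are $a,b>0$ with $ab\le K$ and $\frac1a\|\sum \alpha_j e_j\|\le\|\sum \alpha_j x_j\|\le b\|\sum \alpha_j e_j\|$ for all scalars $\alpha_j$. An $n$-dimensional Banach space $E$ with normalized basis $(e_j)_{j=1}^n$ is in the $n$-th asymptotic structure of $X$ if for all $\varepsilon>0$: $\forall X_1\in\mathrm{cof}(X)\ \exists x_1\in S_{X_1}\ \ldots\ \forall X_n\in\mathrm{cof}(X)\ \exists x_n\in S_{X_n}$ such that $(x_j)_{j=1}^n$ is $(1+\varepsilon)$-equivalent to $(e_j)_{j=1}^n$. $\ell_\infty^n$ is in the $n$-th asymptotic structure of $X$ up to a constant $D$ (for all $n$) if for each $n$ there is an $n$-dimensional space $E_n$ in the $n$-th asymptotic structure of $X$ whose normalized basis is $D$-equivalent to the unit vector basis of $\ell_\infty^n$.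 ''$\ell_\infty^n$ is in the $n$-th asymptotic structure'' refers to its unit vector basis. $[\mathbb{N}]^{\le n}$ is the set of subsets of $\mathbb{N}=\{1,2,\dots\}$ with at most $n$ elements (including $\emptyset$), $[\mathbb{N}]^n$ those with exactly $n$ elements, written in increasing order; $\max(\emptyset):=0$. An enumeration $(A_i)_{i\in\mathbb{N}}$ of $[\mathbb{N}]^{\le n}$ is a compatible linear ordering if $\max(A_i)<\max(A_j)$ implies $i<j$. $X$ contains $(C,D)$-good $\ell_\infty$-trees of arbitrary height ($C,D\ge1$) if for any $n\in\mathbb{N}$ and any compatible linear ordering $(A_i)_{i\in\mathbb{N}}$ of $[\mathbb{N}]^{\le n}$ there are $(x_A)_{A\in[\mathbb{N}]^{\le n}}$ in $S_X$ and $(x_A^* )_{A\in[\mathbb{N}]^{\le n}}$ in $S_{X^*}$ such that: (a) $x_A^*(x_A)=1$ and $x_A^*(x_B)=0$ for all $A,B\in[\mathbb{N}]^{\le n}$ with $\max(B)>\max(A)$; (b) $\frac1C\|(a_i)_{i=0}^n\|_\infty\le\|a_0x_\emptyset+a_1x_{\{b_1\}}+\cdots+a_nx_{\{b_1,\dots,b_n\}}\|\le C\|(a_i)_{i=0}^n\|_\infty$ for all $(a_i)_{i=0}^n\subset\mathbb{R}$ and all $\{b_1<\dots<b_n\}\in[\mathbb{N}]^n$; (c) $\|\sum_{m=1}^ia_mx_{A_m}\|\le D\|\sum_{m=1}^ja_mx_{A_m}\|$ for all $i\le j$ and all real $(a_m)_{m=1}^j$. $X$ contains good $\ell_\infty$-trees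 of arbitrary height almost isometrically if it contains $(1+\varepsilon,1+\varepsilon)$-good $\ell_\infty$-trees of arbitrary height for every $\varepsilon>0$. *)

(* Defs.v *)
From HB Require Import structures.
From mathcomp Require Export all_boot all_order all_algebra finmap.
From mathcomp Require Export all_classical all_reals all_analysis.
Export Order.TTheory GRing.Theory Num.Theory numFieldNormedType.Exports.

Set Implicit Arguments.
Unset Strict Implicit.
Unset Printing Implicit Defensive.

Local Open Scope classical_set_scope.
Local Open Scope ring_scope.

(* The norm on 'rV[R]_n is the sup norm, so 'rV[R]_n is $\ell_\infty^n$. *)
HB.instance Definition _ (R : realType) (m n : nat) :=
  Complete.on 'M[R]_(m, n).

Definition unit_vector (R : realType) (n : nat) (i : 'I_n) : 'rV[R]_n :=
  delta_mx 0 i.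

Definition unit_sphere (R : realType) (V : normedModType R) : set V :=
  [set x | `|x| = 1].

Definition dual_space (R : realType) (X : normedModType R) :
    set {linear X -> R^o} :=
  [set f | continuous f].

Definition dual_norm (R : realType) (X : normedModType R) (f : X -> R) : R :=
  sup [set `|f x| | x in [set x : X | `|x| <= 1]].

Definition separable_dual (R : realType) (X : normedModType R) : Prop :=
  exists S : set {linear X -> R^o},
    [/\ S `<=` @dual_space R X, countable S &
      forall f, dual_space f -> forall eps : R, 0 < eps ->
        exists2 g, S g & dual_norm (f \- g) < eps].

Definition cof (R : realType) (X : normedModType R) : set (set X) :=
  [set Y | [/\ submod_closed (mem Y), closed Y &
    exists (k : nat) (v : 'I_k -> X), forall x : X,
      exists2 y : X, Y y &
        exists c : 'I_k -> R, x = y + \sum_(i < k) c i *: v i]].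

Definition K_equivalent (R : realType) (V W : normedModType R) (n : nat)
    (K : R) (x : 'I_n -> V) (e : 'I_n -> W) : Prop :=
  exists a b : R, [/\ 0 < a, 0 < b, a * b <= K &
    forall alpha : 'I_n -> R,
      a^-1 * `|\sum_(j < n) alpha j *: e j| <= `|\sum_(j < n) alpha j *: x j|
        <= b * `|\sum_(j < n) alpha j *: e j|].

Definition normalized_basis (R : realType) (E : normedModType R) (n : nat)
    (e : 'I_n -> E) : Prop :=
  (forall j, `|e j| = 1) /\
  (forall v : E, exists! c : 'rV[R]_n, v = \sum_(j < n) c 0 j *: e j).

(* [asymptotic_game P k s] holds when, starting from the vectors [s] already
   chosen, k further rounds
     forall X_i in cof(X), exists x_i in the unit sphere of X_i
   can be played so that the resulting sequence of vectors satisfies [P]. *)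
Fixpoint asymptotic_game (R : realType) (X : normedModType R)
    (P : seq X -> Prop) (k : nat) (s : seq X) : Prop :=
  if k is k'.+1 then
    forall Y : set X, cof Y ->
      exists2 x : X, (Y `&` @unit_sphere R X) x &
        asymptotic_game P k' (rcons s x)
  else P s.

Definition in_asymptotic_structure (R : realType)
    (X E : completeNormedModType R) (n : nat) (e : 'I_n -> E) : Prop :=
  normalized_basis e /\
  forall eps : R, 0 < eps ->
    asymptotic_game
      (fun s : seq X => K_equivalent (1 + eps) (fun j : 'I_n => nth 0 s j) e)
      n [::].

Definition linfty_in_asymptotic_structure_upto (R : realType)
    (X : completeNormedModType R) (D : R) : Prop :=
  forall n : nat, (0 < n)%N ->
    exists (E : completeNormedModType R) (e : 'I_n -> E),
      in_asymptotic_structure X e /\ K_equivalent D e (@unit_vector R n).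

(* Since the set of natural numbers starts at 1 here, 0 is excluded. *)
Definition subsets_le (n : nat) : set {fset nat} :=
  [set A | 0%N \notin A /\ (#|` A| <= n)%N].

Definition subsets_eq (n : nat) : set {fset nat} :=
  [set A | 0%N \notin A /\ #|` A| = n].

Definition fset_max (A : {fset nat}) : nat := (\max_(k <- A) k)%N.

(* the i smallest elements of B *)
Definition initial_segment (i : nat) (B : {fset nat}) : {fset nat} :=
  [fset b in take i (sort leq B)]%fset.

(* Enumerations are indexed from 0, shifting the index of $A_i$ by one. *)
Definition compatible_ordering (n : nat) (A : nat -> {fset nat}) : Prop :=
  set_bij [set: nat] (subsets_le n) A /\
  forall i j : nat, (fset_max (A i) < fset_max (A j))%N -> (i < j)%N.

(* Only the values of [x] and [xs] at members of [subsets_le n] matter. *)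
Definition contains_good_linfty_trees (R : realType)
    (X : completeNormedModType R) (C D : R) : Prop :=
  forall (n : nat) (A : nat -> {fset nat}), (0 < n)%N ->
    compatible_ordering n A ->
    exists (x : {fset nat} -> X) (xs : {fset nat} -> {linear X -> R^o}),
      [/\ forall F, subsets_le n F ->
            [/\ `|x F| = 1, dual_space (xs F) & dual_norm (xs F) = 1],
          forall F, subsets_le n F ->
            xs F (x F) = 1 /\
            (forall G, subsets_le n G -> (fset_max F < fset_max G)%N ->
              xs F (x G) = 0),
          forall (a : 'rV[R]_n.+1) (B : {fset nat}), subsets_eq n B ->
            C^-1 * `|a|
              <= `|\sum_(i < n.+1) a 0 i *: x (initial_segment i B)|
              <= C * `|a| &
          forall (i j : nat) (a : nat -> R), (i <= j)%N ->
            `|\sum_(m < i) a m *: x (A m)|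
              <= D * `|\sum_(m < j) a m *: x (A m)|].

Definition contains_good_linfty_trees_almost_isometrically (R : realType)
    (X : completeNormedModType R) : Prop :=
  forall eps : R, 0 < eps -> contains_good_linfty_trees X (1 + eps) (1 + eps).

(* Main.v *)
(* The quantifiers of the asymptotic game give [x_A] in any prescribed
   finite-codimensional subspace, once the vectors on the path from the root to
   [A] are chosen, so the tree can be built along the compatible ordering.
   At each step the new vector is taken in the kernels of norming functionals
   of all earlier vectors, which gives (a), and in the Mazur subspaces of the
   spans of all earlier initial segments, which gives (c) with one factor
   [1 + eps] because each tail lies in the subspace of its initial segment. Every
   branch is a play of the game, which gives (b). *)
From HB Require Import structures.
Require Import Defs.
Set Implicit Arguments.
Unset Strict Implicit.
Unset Printing Implicit Defensive.
Local Open Scope classical_set_scope.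
Local Open Scope ring_scope.

(** * Norming functionals by Hahn-Banach *)

Lemma contraction_continuous (R : realType) (X : normedModType R)
    (f : {linear X -> R^o}) :
  (forall x, `|f x| <= `|x|) -> continuous f.
Proof.
move=> fle; apply/linear_bounded_continuous/linear_boundedP.
near=> M => x /=; apply: (le_trans (fle x)).
by rewrite ler_peMl//; near: M; apply: nbhs_pinfty_ge.
Unshelve. all: by end_near.
Qed.

Lemma dual_norm_contraction (R : realType) (X : normedModType R)
    (f : {linear X -> R^o}) (x : X) :
  (forall x, `|f x| <= `|x|) -> `|x| = 1 -> f x = 1 -> dual_norm f = 1.
Proof.
move=> fle x1 fx1.
have ub1 : ubound [set `|f y| | y in [set y : X | `|y| <= 1]] 1.
  by move=> _ [y /= y1 <-]; apply: le_trans y1.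
have f1 : [set `|f y| | y in [set y : X | `|y| <= 1]] 1.
  by exists x; rewrite ?fx1 ?normr1//= x1.
apply/eqP; rewrite eq_le; apply/andP; split.
  by apply: ge_sup => //; exists 1.
by apply: ub_le_sup => //; exists 1.
Qed.

(* Zorn's lemma is applied to the graphs of partial functionals of norm at
   most 1; the bound [r <= `|x|] on a linear relation makes it functional.
   The empty relation is admitted so that empty chains are covered. *)
Lemma norming_functional (R : realType) (X : normedModType R) (x0 : X) :
  exists f : {linear X -> R^o},
    f x0 = `|x0| /\ forall x, `|f x| <= `|x|.
Proof.
pose P (G : set (X * R)) :=
  [/\ forall a x r y s, G (x, r) -> G (y, s) -> G (a *: x + y, a * r + s),
      forall x r, G (x, r) -> r <= `|x| & forall u, G u -> G (x0, `|x0|)].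
have [|G [[Glin Gle Gx0] Gmax]] := @Zorn_bigcup _ P.
  move=> F FP Ftot; split.
  - move=> a x r y s [A FA Ax] [B FB By].
    have [AB|BA] := Ftot _ _ FA FB.
      by exists B => //; case: (FP _ FB) => + _ _; apply=> //; exact: AB.
    by exists A => //; case: (FP _ FA) => + _ _; apply=> //; exact: BA.
  - by move=> x r [A FA]; case: (FP _ FA) => _ + _; apply.
  - by move=> u [A FA Au]; exists A => //; case: (FP _ FA) => _ _; apply; exact: Au.
have {}Gx0 : G (x0, `|x0|).
  apply: contrapT => nG.
  have G0 u : ~ G u by move=> /Gx0.
  (* An empty maximal graph would be properly extended by the line through [(x0, |x0|)]. *)
  apply: (Gmax (range (fun t : R => (t *: x0, t * `|x0|)))).
    split; first by move=> u /G0.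
    by move=> /(_ (1 *: x0, 1 * `|x0|)) /(_ (imageT _ _)) /G0.
  split.
  - move=> a _ _ _ _ [t _ [<- <-]] [u _ [<- <-]].
    exists (a * t + u) => //.
    by rewrite scalerDl scalerA mulrDl mulrA.
  - by move=> _ _ [t _ [<- <-]]; rewrite normrZ ler_wpM2r// ler_norm.
  - by move=> _ _; exists 1 => //; rewrite scale1r mul1r.
have G00 : G (0, 0).
  by have := Glin (-1) _ _ _ _ Gx0 Gx0; rewrite scaleN1r mulN1r !addNr.
have GD x r y s : G (x, r) -> G (y, s) -> G (x + y, r + s).
  by move=> xr ys; have := Glin 1 _ _ _ _ xr ys; rewrite scale1r mul1r.
have GZ a x r : G (x, r) -> G (a *: x, a * r).
  by move=> xr; have := Glin a _ _ _ _ xr G00; rewrite !addr0.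
have Gtot x : exists r, G (x, r).
  apply: contrapT => nGx.
  (* One-step extension: the value at [x] must lie above every [t - |z - x|] and below every
     [|y + x| - s]. Since [s + t <= |y + z|], the triangle inequality makes the supremum of the
     lower bounds admissible. *)
  pose S := [set u.2 - `|u.1 - x| | u in G].
  have S0 : S !=set0 by exists (0 - `|0 - x|), (0, 0).
  have Sub y s : G (y, s) -> ubound S (`|y + x| - s).
    move=> Gy _ [[z t] /= Gz <-].
    rewrite lerBrDl addrA lerBlDr; apply: le_trans (Gle _ _ (GD _ _ _ _ Gy Gz)) _.
    by apply: le_trans (ler_normD _ _); rewrite addrACA subrr addr0.
  pose r := sup S.
  have rle y s : G (y, s) -> s + r <= `|y + x|.
    by move=> Gy; rewrite -lerBrDl; apply: ge_sup => //; exact: Sub.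
  have ler y s : G (y, s) -> s - r <= `|y - x|.
    move=> Gy; rewrite lerBlDr -lerBlDl; apply: ub_le_sup; last by exists (y, s).
    by exists (`|0 + x| - 0); exact: Sub.
  pose G' := [set v | exists u t, G u /\ v = (u.1 + t *: x, u.2 + t * r)].
  have GG' : G `<=` G'.
    by move=> [y s] Gy; exists (y, s), 0; rewrite scale0r mul0r !addr0.
  apply: (Gmax G').
    split=> // /(_ (x, r)) G'x; apply: nGx; exists r; apply: G'x.
    by exists (0, 0), 1; rewrite scale1r mul1r !add0r.
  split.
  - move=> a _ _ _ _ [[y s] [t [Gy [-> ->]]]] [[z p] [q [Gz [-> ->]]]].
    exists (a *: y + z, a * s + p), (a * t + q); split=> /=.
      exact: Glin.
    congr pair.
      by rewrite scalerDr scalerDl scalerA addrACA.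
    by rewrite mulrDr mulrDl mulrA addrACA.
  - move=> _ _ [[y s] [t [Gy [-> ->]]]] /=.
    (* Dividing by [|t|] reduces to coefficient [-1] or [1] of [x], where [ler] or [rle] applies. *)
    have [t0|t0|->] := ltgtP t 0; last by rewrite scale0r mul0r !addr0; exact: Gle.
    + have nt0 : 0 < - t by rewrite oppr_gt0.
      have := ler _ _ (GZ (- t)^-1 _ _ Gy).
      rewrite -(ler_pM2l nt0) -[X in X * `|_|](gtr0_norm nt0) -normrZ.
      rewrite scalerBr scalerA mulrBr mulrA mulfV ?gt_eqF//.
      by rewrite scale1r mul1r scaleNr mulNr !opprK.
    + have := rle _ _ (GZ t^-1 _ _ Gy).
      rewrite -(ler_pM2l t0) -[X in X * `|_|](gtr0_norm t0) -normrZ.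
      by rewrite scalerDr scalerA mulrDr mulrA mulfV ?gt_eqF// scale1r mul1r.
  - by move=> _ _; exact: GG'.
have Gfun x r s : G (x, r) -> G (x, s) -> r = s.
  have le2 p q : G (x, p) -> G (x, q) -> q <= p.
    move=> xp xq; have := Gle _ _ (Glin (-1) _ _ _ _ xp xq).
    by rewrite scaleN1r mulN1r addNr normr0 addrC subr_le0.
  by move=> xr xs; apply/eqP; rewrite eq_le !le2.
have [f fG] := choice Gtot.
have flin : linear (f : X -> R^o).
  move=> a x y; apply: (Gfun (a *: x + y)); first exact: fG.
  exact: Glin.
pose fL := GRing.isLinear.Build _ _ _ _ _ flin.
pose F : {linear X -> R^o} := HB.pack f fL.
exists F; split; first exact: Gfun (fG x0) Gx0.
move=> x; rewrite ler_norml (Gle _ _ (fG x)) andbT lerNl.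
rewrite -normrN; apply: Gle; have := GZ (-1) _ _ (fG x).
by rewrite scaleN1r mulN1r.
Qed.

(** * Finite-codimensional subspaces *)

(** If [f] vanishes on [Y], the spanning complement is kept. Otherwise some [y0] in [Y] with
    [f y0 != 0] is added to it, and [y - (f y / f y0) y0] lies in the kernel. *)
Lemma cofI_ker (R : realType) (X : normedModType R) (Y : set X)
    (f : {linear X -> R^o}) :
  cof Y -> continuous f -> cof (Y `&` [set x | f x = 0]).
Proof.
move=> [Ysub Ycl [k [v Yv]]] fcont.
have Ylin a y z : Y y -> Y z -> Y (a *: y + z).
  case: Ysub => _ Ylin Yy Yz.
  by have := Ylin a y z; rewrite !inE; apply.
split.
- split; first by rewrite inE; split=> /=; rewrite ?linear0//; case: Ysub => + _; rewrite inE.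
  move=> a y z; rewrite !inE => -[Yy fy] [Yz fz]; split; first exact: Ylin.
  by rewrite /= linearP fy fz scaler0 addr0.
- apply: closedI => //.
  by apply: (@preimage_closed _ _ f [set 0]) => // ; exact: closed1.
have [[y0 [Yy0 fy0]]|fY0] := pselect (exists y, Y y /\ f y != 0); last first.
  exists k, v => x; have [y Yy [c ->]] := Yv x.
  exists y; last by exists c.
  by split=> //=; apply: contrapT => /eqP fy; apply: fY0; exists y.
exists k.+1, (fun i => oapp v y0 (unlift ord0 i)) => x.
have [y Yy [c xE]] := Yv x.
exists (- (f y / f y0) *: y0 + y).
  split; first exact: Ylin.
  by rewrite /= linearP /= scaleNr /GRing.scale /= divfK// addNr.
exists (fun i => oapp c (f y / f y0) (unlift ord0 i)).
rewrite big_ord_recl unlift_none /= addrACA scaleNr addNr add0r xE.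
congr (_ + _); by apply: eq_bigr => i _; rewrite liftK.
Qed.

(* A reformulation of finite codimension, closed under finite intersections
   without any dimension count. *)
Definition cof_meet (R : realType) (X : normedModType R) (Y : set X) : Prop :=
  forall Z : set X, cof Z -> cof (Z `&` Y).

Lemma cof_setT (R : realType) (X : normedModType R) : @cof R X setT.
Proof.
split; [by split=> [|a x y _ _]; rewrite inE|exact: closedT|].
by exists 0%N, (fun=> 0) => x; exists x => //; exists (fun=> 0); rewrite big_ord0 addr0.
Qed.

Lemma cof_meet_cof (R : realType) (X : normedModType R) (Y : set X) :
  cof_meet Y -> cof Y.
Proof. by move=> /(_ _ (@cof_setT R X)); rewrite setTI. Qed.

Lemma cof_meetT (R : realType) (X : normedModType R) : @cof_meet R X setT.
Proof. by move=> Z; rewrite setIT. Qed.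

Lemma cof_meetI (R : realType) (X : normedModType R) (Y Z : set X) :
  cof_meet Y -> cof_meet Z -> cof_meet (Y `&` Z).
Proof. by move=> Ym Zm T /Ym /Zm; rewrite setIA. Qed.

Lemma cof_meet_ker (R : realType) (X : normedModType R)
    (f : {linear X -> R^o}) :
  continuous f -> cof_meet [set x | f x = 0].
Proof. by move=> fcont Z Zcof; exact: cofI_ker. Qed.

Lemma cof_meet_seq (R : realType) (X : normedModType R) (I : eqType)
    (s : seq I) (Y : I -> set X) :
  (forall i, i \in s -> cof_meet (Y i)) ->
  cof_meet [set x | forall i, i \in s -> Y i x].
Proof.
elim: s => [|i s IHs] Ym.
  by rewrite (_ : [set _ | _] = setT); [exact: cof_meetT|by rewrite -subTset].
rewrite (_ : [set _ | _] = Y i `&` [set x | forall j, j \in s -> Y j x]).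
  apply: cof_meetI; first by apply: Ym; rewrite mem_head.
  by apply: IHs => j js; apply: Ym; rewrite in_cons js orbT.
apply/seteqP; split=> x.
  by move=> xY; split=> [|j js]; apply: xY; rewrite in_cons ?eqxx ?js ?orbT.
by move=> [Yix Ysx] j; rewrite in_cons => /predU1P[->|/Ysx].
Qed.

(** * Finite-dimensional spans and Mazur's lemma *)

Lemma continuous_linear_combination (R : realType) (X : normedModType R)
    (k : nat) (s : 'I_k -> X) :
  continuous (fun a : 'rV[R]_k => \sum_i a 0 i *: s i).
Proof.
move=> a; elim: (index_enum _) => [|i r IHr].
  have -> : (fun b : 'rV[R]_k => \sum_(i <- [::]) b 0 i *: s i) = cst 0.
    by apply/funext => b; rewrite big_nil.
  exact: cst_continuous.
have -> : (fun b : 'rV[R]_k => \sum_(j <- i :: r) b 0 j *: s j) =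
    (fun b : 'rV[R]_k => b 0 i *: s i)
    + (fun b : 'rV[R]_k => \sum_(j <- r) b 0 j *: s j).
  by apply/funext => b; rewrite big_cons.
apply: continuousD; last exact: IHr.
apply: continuousZr_tmp.
exact: coord_continuous.
Qed.

(* Mazur's lemma: a finite set of functionals norming the span of [s] up to
   [1 + eps], found by compactness of a box of coefficients, cuts out [Y]. *)
Lemma mazur (R : realType) (X : normedModType R) (k : nat) (s : 'I_k -> X)
    (M eps : R) :
  (forall (a : 'I_k -> R) i, `|a i| <= M * `|\sum_i a i *: s i|) ->
  0 < eps ->
  exists2 Y : set X, cof_meet Y & forall (a : 'I_k -> R) (y : X), Y y ->
    `|\sum_i a i *: s i| <= (1 + eps) * `|\sum_i a i *: s i + y|.
Proof.
move=> sM eps0; have eps10 : 0 < 1 + eps by rewrite addr_gt0.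
have [f fP] := choice (@norming_functional R X).
pose v (a : 'rV[R]_k) := \sum_i a 0 i *: s i.
have vcont : continuous v by exact: continuous_linear_combination.
pose K := [set a : 'rV[R]_k | forall i, `[- M, M]%classic (a 0 i)].
(* On a vector of norm 1, the defect [eps / (1 + eps)] leaves the functional a value above
   [1 / (1 + eps)]. *)
pose U (a : 'rV[R]_k) := [set b | `|v b| - f (v a) (v b) < eps / (1 + eps)].
have Kcomp : compact K.
  by apply: (@rV_compact _ _ (fun=> `[- M, M]%classic)) => _; exact: segment_compact.
move: Kcomp; rewrite compact_cover => /(_ _ setT U)[].
- move=> a _; rewrite /U.
  apply: (@open_comp _ _ (fun b => `|v b| - f (v a) (v b))
    [set r | r < eps / (1 + eps)]); last exact: open_lt.
  move=> b _.
  apply: (@continuousB R R^o _ (fun b => `|v b|) (fun b => f (v a) (v b))).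
    by apply: continuous_comp; [exact: vcont|exact: norm_continuous].
  apply: continuous_comp; [exact: vcont|].
  by apply: contraction_continuous; case: (fP (v a)).
- move=> a _; exists a => //.
  by rewrite /U/= (fP (v a)).1 subrr divr_gt0.
move=> D _ KD; exists [set x | forall a, a \in enum_fset D -> f (v a) x = 0].
  apply: cof_meet_seq => a _; apply: cof_meet_ker.
  by apply: contraction_continuous; case: (fP (v a)).
move=> a y Yy; set w := \sum_i _.
have [->|w0] := eqVneq w 0; first by rewrite normr0 mulr_ge0// ltW.
have nw0 : 0 < `|w| by rewrite normr_gt0.
(* The coefficients of [w / |w|] lie in the box by the hypothesis on [M], so a functional [f (v c)]
   of the finite subcover almost norms [w]. *)
pose b : 'rV[R]_k := \row_i (`|w|^-1 * a i).
have vb : v b = `|w|^-1 *: w.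
  by rewrite /v /w scaler_sumr; apply: eq_bigr => i _; rewrite mxE scalerA.
have Kb : K b.
  move=> i /=; rewrite mxE in_itv/= -ler_norml normrM normfV normr_id.
  by rewrite ler_pdivrMl// mulrC; exact: sM.
have [c cD] := KD _ Kb.
rewrite /U /= vb normrZ normfV normr_id mulVf ?gt_eqF// linearZ.
rewrite -(ltr_pM2l nw0) /= => fw.
(* As [f (v c)] kills [y], its value at [w] is at most [|w + y|]. *)
have := (fP (v c)).2 (w + y); rewrite linearD (Yy c cD) addr0 => fwy.
have {fw} : `|w| - f (v c) w < `|w| * (eps / (1 + eps)).
  by move: fw; rewrite mulrBr mulr1 /GRing.scale /= mulrA mulfV ?gt_eqF// mul1r.
rewrite ltrBlDr -ltrBlDl -[X in X - _]mulr1 -mulrBr.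
rewrite -[X in X - _](mulfV (lt0r_neq0 eps10)) -mulrBl addrK mul1r.
rewrite ltr_pdivrMr// => /ltW /le_trans -> //.
rewrite mulrC ler_pM2l//; exact: le_trans (ler_norm _) fwy.
Qed.

(** Supplies the constant [M] of [mazur]. Applying [g j] to the sum kills all terms after [j], so
    [a j] is controlled by the sum and the earlier coefficients. *)
Lemma triangular_coef_bound (R : realType) (X : normedModType R) (k : nat)
    (s : nat -> X) (g : nat -> {linear X -> R^o}) :
  (forall m x, `|g m x| <= `|x|) -> (forall m, (m < k)%N -> `|s m| = 1) ->
  (forall m, (m < k)%N -> g m (s m) = 1) ->
  (forall i j, (i < j < k)%N -> g i (s j) = 0) ->
  exists M : R, forall (a : nat -> R) m, (m < k)%N ->
    `|a m| <= M * `|\sum_(i < k) a i *: s i|.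
Proof.
move=> gle s1 gs1 gs0.
(* The condition [m < k] is doubled so that the induction runs on the number of coefficients already
   bounded, with the full sum held fixed. *)
suff [M _ sM] : exists2 M : R, 0 <= M & forall (a : nat -> R) m,
    (m < k)%N -> (m < k)%N -> `|a m| <= M * `|\sum_(i < k) a i *: s i|.
  by exists M => a m mk; exact: sM.
elim: {1}k => [|j [M M0 IH]]; first by exists 0.
(* The part [1 + M *+ j] bounds the new coefficient; the extra [M] keeps the old bounds. *)
exists (M + 1 + M *+ j) => [|a m]; first by rewrite !addr_ge0// mulrn_wge0.
rewrite ltnS leq_eqVlt => /predU1P[->{m} jk|mj mk]; last first.
  apply: (le_trans (IH a m mj mk)); rewrite ler_wpM2r// -addrA lerDl.
  by rewrite addr_ge0// mulrn_wge0.
set w := \sum_(i < k) _.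
have aE : a j = g j w - \sum_(i < j) a i * g j (s i).
  apply/eqP; rewrite eq_sym subr_eq; apply/eqP.
  rewrite /w linear_sum -(subnKC jk) /= addSnnS big_split_ord /= addrC.
  congr (_ + _); last first.
    by apply: eq_bigr => i _; rewrite linearZ.
  rewrite big_ord_recl /= addn0 linearZ gs1// big1 ?addr0.
    exact: mulr1.
  move=> i _; rewrite linearZ /= gs0 ?scaler0//.
  by rewrite /bump add1n addnS ltnS leq_addr/= -addSn -ltn_subRL.
have {aE} : `|a j| <= `|w| + \sum_(i < j) `|a i|.
  rewrite aE; apply: le_trans (ler_normB _ _) _.
  apply: lerD => //; apply: le_trans (ler_norm_sum _ _ _) _.
  apply: ler_sum => i _; rewrite normrM ler_piMr//.
  by apply: le_trans (gle _ _) _; rewrite s1// (ltn_trans (ltn_ord i)).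
move=> /le_trans; apply; rewrite -addrA mulrDl.
rewrite -[leLHS]add0r; apply: lerD; first by rewrite mulr_ge0.
rewrite mulrDl mul1r lerD2l -[X in _ *+ X]card_ord -sumr_const mulr_suml.
by apply: ler_sum => i _; apply: IH => //; exact: ltn_trans jk.
Qed.

(** * Playing the game along a tree *)

(** The subspace offered at node [m] depends on all vectors chosen so far, but the game is followed
    only along the ancestors [anc m]. Every node records a position from which play can still
    succeed, so several children can continue from the same parent. *)
Lemma game_tree (R : realType) (X : normedModType R) (P : seq X -> Prop)
    (N : nat) (anc : nat -> seq nat) (W : seq X -> set X) :
  (forall m, anc m = [::] \/ exists2 p, (p < m)%N & anc m = rcons (anc p) p) ->
  (forall m, size (anc m) < N)%N -> (forall s, cof (W s)) ->
  asymptotic_game P N [::] ->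
  exists x : nat -> X, forall m,
    [/\ W (mkseq x m) (x m), `|x m| = 1 &
        asymptotic_game P (N - (size (anc m)).+1)
          [seq x p | p <- rcons (anc m) m]].
Proof.
move=> ancP ancN Wcof P0.
have anc_lt m : all (fun p => p < m)%N (anc m).
  elim/ltn_ind: m => m IH; have [->//|[p pm ->]] := ancP m.
  rewrite all_rcons pm; apply: sub_all (IH _ pm) => q /ltn_trans; exact.
pose good s y := [/\ W s y, `|y| = 1 &
  asymptotic_game P (N - (size (anc (size s))).+1)
    (rcons [seq nth 0 s p | p <- anc (size s)] y)].
(* The default 0 makes the step total, so the recursion is defined before its steps are known to be
   good. *)
have goodE s : exists y, (exists z, good s z) -> good s y.
  have [[y sy]|ns] := pselect (exists y, good s y); first by exists y.
  by exists 0.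
have [step stepP] := choice goodE.
pose hist m := iter m (fun s => rcons s (step s)) [::].
pose x m := step (hist m).
have histE m : hist m = mkseq x m.
  by elim: m => // m IH; rewrite mkseqS -IH.
have pastE m : [seq nth 0 (mkseq x m) p | p <- anc m] = [seq x p | p <- anc m].
  apply/eq_in_map => p /(allP (anc_lt m)) pm.
  by rewrite nth_mkseq.
exists x; elim/ltn_ind => m IH.
suff : good (mkseq x m) (x m).
  by rewrite /good size_mkseq pastE map_rcons.
rewrite {2}/x histE; apply: stepP; rewrite /good size_mkseq pastE.
(* The position before node [m] is the opening one or the one left by its parent. *)
have : asymptotic_game P (N - size (anc m)) [seq x p | p <- anc m].
  have [->|[p pm ->]] := ancP m; first by rewrite subn0.
  by rewrite size_rcons; case: (IH _ pm).
rewrite -(subnSK (ancN m)) => /(_ _ (Wcof (mkseq x m)))[y [Wy y1] yP].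
by exists y.
Qed.

(** * Equivalence with the unit vector basis *)

Lemma K_equivalent_trans (R : realType) (U V W : normedModType R) (n : nat)
    (K L : R) (x : 'I_n -> U) (y : 'I_n -> V) (z : 'I_n -> W) :
  K_equivalent K x y -> K_equivalent L y z -> K_equivalent (K * L) x z.
Proof.
move=> [a [b [a0 b0 abK xy]]] [c [d [c0 d0 cdL yz]]].
exists (a * c), (b * d); split; rewrite ?mulr_gt0//.
  by rewrite mulrACA ler_pM// mulr_ge0// ltW.
move=> t; have /andP[xl xu] := xy t; have /andP[yl yu] := yz t.
apply/andP; split.
  by rewrite invfM -mulrA; apply: le_trans xl; rewrite ler_wpM2l// invr_ge0 ltW.
by apply: (le_trans xu); rewrite -mulrA ler_wpM2l// ltW.
Qed.

Lemma K_equivalent_refl (R : realType) (V : normedModType R) (n : nat)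
    (x : 'I_n -> V) : K_equivalent 1 x x.
Proof. by exists 1, 1; split; rewrite ?mulr1// => a; rewrite invr1 !mul1r lexx. Qed.

Lemma sum_unit_vector (R : realType) (n : nat) (a : 'I_n -> R) :
  \sum_j a j *: unit_vector R j = \row_j a j.
Proof.
rewrite [RHS]row_sum_delta; apply: eq_bigr => j _.
by rewrite mxE.
Qed.

Lemma norm_unit_vector (R : realType) (n : nat) (j : 'I_n) :
  `|unit_vector R j| = 1.
Proof.
rewrite -[LHS]/(mx_norm _) mx_normrE; apply/eqP; rewrite eq_le; apply/andP; split.
  apply/bigmax_leP; split=> // -[i k] _ /=.
  by rewrite mxE normr_nat lern1 leq_b1.
by apply/bigmax_geP; right; exists (0, j); rewrite //= mxE !eqxx normr1.
Qed.

(* Testing on the unit vectors shows that the two equivalence constants are at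
   least 1, hence each of them is at most their product. *)
Lemma K_equivalent_linfty (R : realType) (V : normedModType R) (n : nat)
    (K : R) (x : 'I_n.+1 -> V) (a : 'rV[R]_n.+1) :
  (forall j, `|x j| = 1) -> K_equivalent K x (@unit_vector R n.+1) ->
  K^-1 * `|a| <= `|\sum_j a 0 j *: x j| <= K * `|a|.
Proof.
move=> x1 [p [q [p0 q0 pqK xE]]].
have sum1 (W : lmodType R) (y : 'I_n.+1 -> W) :
    \sum_j (j == 0)%:R *: y j = y 0.
  rewrite (bigD1 0)//= scale1r big1 ?addr0// => j /negPf ->.
  by rewrite scale0r.
have := xE (fun j => (j == 0)%:R); rewrite !sum1 norm_unit_vector x1 !mulr1.
rewrite invf_le1// => /andP[p1 q1].
have pK : p <= K by apply: le_trans pqK; rewrite ler_peMr// ltW.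
have qK : q <= K by apply: le_trans pqK; rewrite ler_peMl// ltW.
have K0 : 0 < K by exact: lt_le_trans pK.
have := xE (fun j => a 0 j); rewrite sum_unit_vector.
have -> : \row_j a 0 j = a by apply/rowP => j; rewrite mxE.
move=> /andP[al au]; apply/andP; split.
  by apply: le_trans al; rewrite ler_wpM2r// lef_pV2.
by apply: (le_trans au); rewrite ler_wpM2r.
Qed.

(** * Initial segments of finite sets *)

Lemma sort_leq_fset_sorted (B : {fset nat}) : sorted ltn (sort leq B).
Proof.
by rewrite ltn_sorted_uniq_leq sort_uniq fset_uniq sort_sorted//; exact: leq_total.
Qed.

Lemma sort_initial_segment (i : nat) (B : {fset nat}) :
  sort leq (initial_segment i B) = take i (sort leq B).
Proof.
apply: (irr_sorted_eq ltn_trans ltnn).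
- exact: sort_leq_fset_sorted.
- exact/take_sorted/sort_leq_fset_sorted.
- by move=> b; rewrite mem_sort in_fset.
Qed.

Lemma initial_segment_id (B : {fset nat}) : initial_segment #|` B| B = B.
Proof.
apply/fsetP => b; rewrite in_fset /= take_oversize ?size_sort//.
by rewrite mem_sort.
Qed.

Lemma initial_segmentK (i j : nat) (B : {fset nat}) :
  (i <= j)%N -> initial_segment i (initial_segment j B) = initial_segment i B.
Proof. by move=> ij; rewrite {1}/initial_segment sort_initial_segment take_takel. Qed.

Lemma card_initial_segment (i : nat) (B : {fset nat}) :
  #|` initial_segment i B| = minn i #|` B|.
Proof.
rewrite -[LHS](size_sort leq) sort_initial_segment size_take size_sort.
by rewrite /minn.
Qed.

Lemma subset_initial_segment (i : nat) (B : {fset nat}) :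
  {subset initial_segment i B <= B}.
Proof. by move=> b; rewrite in_fset /= => /mem_take; rewrite mem_sort. Qed.

Lemma fset_max_initial_segment (i : nat) (B : {fset nat}) :
  0%N \notin B -> (i < #|` B|)%N ->
  (fset_max (initial_segment i B) < fset_max B)%N.
Proof.
move=> B0 iB; set b := nth 0%N (sort leq B) i.
have bB : b \in B by rewrite -(mem_sort leq) mem_nth// size_sort.
have b0 : (0 < b)%N by rewrite lt0n; apply: contra B0 => /eqP <-.
apply: (@leq_trans b); last exact: leq_bigmax_seq.
(* Bounding the maximum by [b.-1] also covers the empty segment, because [b] is positive. *)
rewrite -(prednK b0) ltnS; apply/bigmax_leqP_seq => c + _.
rewrite in_fset /= => /(nthP 0%N)[j]; rewrite size_take_min leq_min => /andP[ji jB] <-.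
rewrite nth_take// -ltnS prednK//.
by apply: (sorted_ltn_nth ltn_trans) => //; [exact: sort_leq_fset_sorted|rewrite inE size_sort].
Qed.

(** * Construction of the tree *)

Lemma cof_sum (R : realType) (X : normedModType R) (Y : set X) (I : Type)
    (r : seq I) (P : pred I) (a : I -> R) (F : I -> X) :
  cof Y -> (forall i, P i -> Y (F i)) -> Y (\sum_(i <- r | P i) a i *: F i).
Proof.
move=> [[Y0 Ylin] _ _] YF; rewrite -[Y _]inE.
elim/big_rec: _ => // i y Pi Yy.
by apply: Ylin => //; rewrite inE; exact: YF.
Qed.

Lemma good_linfty_trees (R : realType) (X : completeNormedModType R)
    (D eps : R) :
  0 < eps -> linfty_in_asymptotic_structure_upto X D ->
  contains_good_linfty_trees X (D * (1 + eps)) (1 + eps).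
Proof.
move=> eps0 XD n A _ [Abij Acomp].
(* A branch has [n.+1] vertices, counting the root at the empty set. *)
have [E [e [[_ /(_ _ eps0) eX] eD]]] := XD n.+1 isT.
have [f fP] := choice (@norming_functional R X).
have fle x := (fP x).2.
have fcont x : continuous (f x) by exact/contraction_continuous/fle.
pose triangular (s : seq X) :=
  (forall m, (m < size s)%N -> `|nth 0 s m| = 1) /\
  (forall i j, (i < j < size s)%N -> f (nth 0 s i) (nth 0 s j) = 0).
(* Sequences that are not triangular get the whole space, so that [Y] is defined on every
   history. *)
have mazur_seq (s : seq X) : exists Y : set X, cof_meet Y /\
    (triangular s -> forall (a : nat -> R) (y : X), Y y ->
      `|\sum_(i < size s) a i *: nth 0 s i|
        <= (1 + eps) * `|\sum_(i < size s) a i *: nth 0 s i + y|).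
  have [[s1 s0]|nt] := pselect (triangular s); last first.
    by exists setT; split=> //; exact: cof_meetT.
  have [||||M sM] := @triangular_coef_bound _ _ (size s) (nth 0 s)
      (fun m => f (nth 0 s m)) => //.
    by move=> m ms; rewrite (fP _).1 s1.
  pose v (i : 'I_(size s)) := nth 0 s i.
  have [|Y Ycof YP] := @mazur _ _ _ v M eps _ eps0.
    move=> a i; have := sM (fun m => oapp a 0 (insub m)) i (ltn_ord i).
    rewrite valK /=; under eq_bigr => j _ do rewrite valK /=.
    exact.
  by exists Y; split=> // _ a y /(YP (fun i => a i)).
have [Y YP] := choice mazur_seq.
have Ycof s : cof (Y s) by apply: cof_meet_cof; case: (YP s).
(* The index [size s] is included to impose [Y s] itself; there [nth] returns 0, and the kernel of
   [f 0] is one more harmless constraint. *)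
pose W (s : seq X) := [set x | forall i, i \in iota 0 (size s).+1 ->
  (Y (take i s) `&` [set x | f (nth 0 s i) x = 0]) x].
have Wcof s : cof (W s).
  apply/cof_meet_cof/cof_meet_seq => i _; apply: cof_meetI.
    by case: (YP (take i s)).
  exact: cof_meet_ker.
have AE m : subsets_le n (A m) by exact: (set_bij_homo Abij).
have [idx idxK] : exists idx : {fset nat} -> nat,
    forall F, subsets_le n F -> A (idx F) = F.
  have exidx F : exists i, subsets_le n F -> A i = F.
    have [nF|nF] := pselect (subsets_le n F); last by exists 0%N.
    by have [i _ <-] := set_bij_surj Abij nF; exists i.
  by have [idx ?] := choice exidx; exists idx.
have AK m : idx (A m) = m.
  by apply: (set_bij_inj Abij); rewrite ?inE//; exact: idxK.
have idx_lt F G : subsets_le n F -> subsets_le n G ->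
    (fset_max F < fset_max G)%N -> (idx F < idx G)%N.
  by move=> nF nG FG; apply: Acomp; rewrite !idxK.
have init_le i F : subsets_le n F -> subsets_le n (initial_segment i F).
  move=> [F0 Fn]; split; last by rewrite card_initial_segment geq_min Fn orbT.
  by apply: contra F0; exact: subset_initial_segment.
(* The ancestors of [A m] are its proper initial segments; compatibility of the ordering places them
   before [m]. *)
pose anc m := [seq idx (initial_segment i (A m)) | i <- iota 0 #|` A m|].
have [||x xP] := game_tree (anc := anc) _ _ Wcof eX.
- move=> m; case Am: #|` A m| => [|k]; first by left; rewrite /anc Am.
  have Fn := init_le k _ (AE m).
  right; exists (idx (initial_segment k (A m))).
    rewrite -[X in (_ < X)%N]AK; apply: idx_lt => //.
    by apply: fset_max_initial_segment; rewrite ?Am//; case: (AE m).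
  rewrite /anc Am -addn1 iotaD map_cat cats1; congr rcons.
  rewrite idxK// card_initial_segment Am (minn_idPl (leqnSn k)).
  apply/eq_in_map => i; rewrite mem_iota add0n /= => ik.
  by rewrite initial_segmentK// ltnW.
- by move=> m; rewrite size_map size_iota ltnS; case: (AE m).
have x1 m : `|x m| = 1 by case: (xP m).
have xY i j : (i <= j)%N -> Y (mkseq x i) (x j).
  move=> ij; have [/(_ i)] := xP j.
  rewrite mem_iota size_mkseq add0n ltnS ij => /(_ isT)[+ _] _ _.
  by rewrite /mkseq -map_take take_iota (minn_idPl ij).
have xf i j : (i < j)%N -> f (x i) (x j) = 0.
  move=> ij; have [/(_ i)] := xP j.
  rewrite mem_iota size_mkseq add0n ltnS (ltnW ij) => /(_ isT)[_ +] _ _.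
  by rewrite /= nth_mkseq.
have xtri i : triangular (mkseq x i).
  split=> [m|j k]; rewrite size_mkseq; first by move=> mi; rewrite nth_mkseq.
  by move=> /andP[jk ki]; rewrite !nth_mkseq ?xf// (ltn_trans jk).
exists (fun F => x (idx F)), (fun F => f (x (idx F))); split.
- move=> F nF; split=> //.
  by apply: (@dual_norm_contraction _ _ _ (x (idx F))) => //; rewrite (fP _).1.
- move=> F nF; split; first by rewrite (fP _).1.
  by move=> G nG FG; apply: xf; exact: idx_lt.
- move=> a B [B0 Bn].
  have nB : subsets_le n B by split=> //; rewrite Bn.
  (* At a set of [n] elements no rounds remain, so the whole branch satisfies the equivalence sought
     in the game. *)
  have [_ _] := xP (idx B); rewrite size_map size_iota idxK// Bn subnn /=.
  have -> : rcons (anc (idx B)) (idx B) =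
      [seq idx (initial_segment i B) | i <- iota 0 n.+1].
    rewrite /anc idxK// Bn -[in RHS]addn1 iotaD map_cat cats1 add0n /=.
    by congr (rcons _ (idx _)); rewrite -Bn initial_segment_id.
  rewrite -map_comp => /K_equivalent_trans /(_ eD).
  rewrite mulrC => /(K_equivalent_linfty a) xB.
  have nthE (j : 'I_n.+1) : nth 0
      [seq (x \o (fun i => idx (initial_segment i B))) i | i <- iota 0 n.+1] j
      = x (idx (initial_segment j B)).
    by rewrite (nth_map 0%N) ?size_iota// nth_iota.
  under eq_bigr => j _ do rewrite -nthE.
  by apply: xB => j; rewrite nthE.
- move=> i j a ij; under eq_bigr do rewrite AK.
  under [in leRHS]eq_bigr do rewrite AK.
  have sumE : \sum_(m < i) a m *: nth 0 (mkseq x i) m = \sum_(m < i) a m *: x m.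
    by apply: eq_bigr => m _; rewrite nth_mkseq.
  have [_ /(_ (xtri i) a)] := YP (mkseq x i); rewrite size_mkseq sumE => YiP.
  (* The sum is split at [i]: the tail lies in the single subspace [Y (mkseq x i)], so the factor
     [1 + eps] is paid once. *)
  rewrite -[in leRHS](big_mkord xpredT (fun m => a m *: x m)).
  rewrite (big_cat_nat _ ij)//= big_mkord; apply: YiP.
  by rewrite big_nat; apply: cof_sum => // m /andP[im _]; exact: xY.
Qed.

Theorem lemma3p4 (R : realType) (X : completeNormedModType R)
    (hX : separable_dual X) :
  (forall D : R, 1 <= D ->
     linfty_in_asymptotic_structure_upto X D ->
     forall eps : R, 0 < eps ->
       contains_good_linfty_trees X (D * (1 + eps)) (1 + eps)) /\
  ((forall n : nat, (0 < n)%N ->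
      in_asymptotic_structure X (@unit_vector R n)) ->
   contains_good_linfty_trees_almost_isometrically X).
Proof.
split=> [D _ XD eps eps0|Xlinfty eps eps0]; first exact: good_linfty_trees.
(* This is the case [D = 1], with the unit vectors themselves as the basis. *)
rewrite -{1}[1 + eps]mul1r; apply: good_linfty_trees => // n n0.
exists 'rV[R]_n, (@unit_vector R n); split; first exact: Xlinfty.
exact: K_equivalent_refl.
Qed.
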